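(* Let $0<d_1\mid\cdots\mid d_r$ be the invariant factors of $B$, where $r=\operatorname{rank}(B)$. For any positive integers $p,q$, if $\gcd(p,d_i)\gcd(q,d_i)\mid d_i$ for all $1\le i\le r$ and $[\mathbf b]_{pq}\in\mathrm{Col}_{pq}(B)$, then $$\#M\big(\mathcal{A}_q^{(B,\mathbf b)}\big)\le \#M\big(\mathcal{A}_{pq}^{(B,\mathbf b)}\big).$$ Moreover, when $l=0$, for all positive integers $p,q$ we have $$\#M(\mathcal{A}_q)\le \#M(\mathcal{A}_{pq}).$$
   Context: Let $A$ be an $m\times n$ integer matrix with rows $\boldsymbol\alpha_1^T,\dots,\boldsymbol\alpha_m^T$, $B$ an $l\times n$ integer matrix ($l=0$ is allowed: no equations), $\mathbf a=(a_1,\dots,a_m)^T\in\mathbb{Z}^m$, and $\mathbf b\in\mathbb{Z}^l$. For a positive integer $q$, $\mathbb{Z}_q=\mathbb{Z}/q\mathbb{Z}$ and $[\cdot]_q$ is the entrywise reduction modulo $q$; $\mathrm{Col}_q(B)\subseteq\mathbb{Z}_q^l$ is the $\mathbb{Z}_q$-submodule generated by the columns of $[B]_q$. Put $V_q(B,\mathbf b)=\{\mathbf x\in\mathbb{Z}_q^n : [B]_q\mathbf x=[\mathbf b]_q\}$, $H_{i,q}^{(B,\mathbf b)}=\{\mathbf x\in V_q(B,\mathbf b): [\boldsymbol\alpha_i^T]_q\mathbf x=[a_i]_q\}$, and $M\big(\mathcal{A}_q^{(B,\mathbf b)}\big)=V_q(B,\mathbf b)\setminus\bigcup_{i=1}^m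 H_{i,q}^{(B,\mathbf b)}$. When $l=0$, $V_q(B,\mathbf b)=\mathbb{Z}_q^n$ and $M\big(\mathcal{A}_q^{(B,\mathbf b)}\big)$ is written $M(\mathcal{A}_q)$. The invariant factors of an integer matrix are the nonzero diagonal entries (taken positive, each dividing the next) of its Smith normal form. *)

(* Defs.v *)
From HB Require Import structures.
From mathcomp Require Import all_boot all_order all_algebra.

Set Implicit Arguments.
Unset Strict Implicit.
Unset Printing Implicit Defensive.

Import Order.TTheory GRing.Theory Num.Theory.
Local Open Scope ring_scope.

(* The library's 'Z_q is Z/2Z for q = 1, and the library's ring structure on
   'I_q starts at q = 2.  Zmod q is Z/qZ for every q > 0, the zero ring for
   q = 1 included, which is why it is only a comPzRingType.  Zmod 0 is a junk
   value (a copy of Zmod 1). *)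
Definition Zmod (q : nat) : Type := 'I_(q.-1.+1).

HB.instance Definition _ (q : nat) := Finite.on (Zmod q).
HB.instance Definition _ (q : nat) := GRing.Zmodule.on (Zmod q).
HB.instance Definition _ (q : nat) :=
  GRing.Zmodule_isComPzRing.Build (Zmod q)
    (@Zp_mulA _) (@Zp_mulC _) (@Zp_mul1z _) (@Zp_mul_addl _).

Lemma card_Zmod (q : nat) : (0 < q)%N -> #|{: Zmod q}| = q.
Proof. by case: q => // q _; rewrite card_ord. Qed.

Lemma intr_Zmod_eq (q : nat) (x y : int) : (0 < q)%N ->
  (x%:~R == y%:~R :> Zmod q) = (x == y %[mod q%:Z])%Z.
Proof.
case: q => // q _.
have natrE (k : nat) : k%:R = inZp k :> Zmod q.+1.
  elim: k => [|k IHk]; first by apply: val_inj; rewrite /= mod0n.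
  by rewrite mulrS IHk; apply: val_inj; rewrite /= modnDm add1n.
rewrite eqz_mod_dvd -subr_eq0 -rmorphB /=.
case: (intP (x - y)) => [|k|k].
- by rewrite eqxx dvdz0.
- by rewrite -pmulrn natrE -val_eqE.
- by rewrite dvdzE abszN mulrNz oppr_eq0 -pmulrn natrE -val_eqE.
Qed.

Section Defs.
Variables (m n l : nat).
Implicit Types (A : 'M[int]_(m, n)) (a : 'cV[int]_m).
Implicit Types (B : 'M[int]_(l, n)) (b : 'cV[int]_l).

Definition mxmod (q : nat) (k1 k2 : nat) (C : 'M[int]_(k1, k2)) :
  'M[Zmod q]_(k1, k2) := map_mx intr C.

Definition Col (q : nat) B : {set 'cV[Zmod q]_l} :=
  [set \sum_(j < n) c j *: col j (mxmod q B) | c : {ffun 'I_n -> Zmod q}].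

Definition V (q : nat) B b : {set 'cV[Zmod q]_n} :=
  [set x | mxmod q B *m x == mxmod q b].

Definition H (q : nat) A a B b (i : 'I_m) : {set 'cV[Zmod q]_n} :=
  [set x in V q B b | (mxmod q (row i A) *m x) 0 0 == (a i 0)%:~R].

Definition M (q : nat) A a B b : {set 'cV[Zmod q]_n} :=
  V q B b :\: \bigcup_(i < m) H q A a B b i.

(* Without the bound on the size of d, entries of d that fall outside the
   matrix would be unconstrained. *)
Definition invariant_factors B (d : seq nat) : Prop :=
  [/\ all (leq 1) d, sorted dvdn d, (size d <= minn l n)%N &
      exists (P : 'M[int]_l) (Q : 'M[int]_n),
        [/\ P \in unitmx, Q \in unitmx &
            P *m B *m Q =
              \matrix_(i, j) ((nth 0%N d i)%:Z *+ (i == j :> nat))]].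

Lemma invariant_factors_exist B : exists d : seq nat, invariant_factors B d.
Proof.
have [L uL [R uR [d sd ->]]] := int_Smith_normal_form B.
pose d1 := [seq x <- d | x != 0].
have tr_dvd : transitive dvdz by move=> x y z; apply: dvdz_trans.
have nth_d1 i : d1`_i = d`_i.
  rewrite /d1; elim: d sd i {d1} => //= x s IHs ps i.
  have [x0 | nz_x] /= := eqVneq x 0; last first.
    by case: i => //= i; apply: IHs; apply: path_sorted ps.
  have /allP s0 : all (pred1 0) s.
    have := order_path_min tr_dvd ps; rewrite x0.
    by apply: sub_all => y /=; rewrite -dvd0z.
  have -> : [seq y <- s | y != 0] = [::].
    apply/eqP; rewrite -[_ == _]negbK -has_filter; by apply/hasPn=> y /s0 /= ->.
  rewrite nth_nil; case: i => [|i] /=; first by rewrite x0.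
  have [lti|gei] := ltnP i (size s); last by rewrite nth_default.
  by have /eqP-> := s0 _ (mem_nth 0 lti).
pose e := map absz (take (minn l n) d1).
have nth_e i : (i < minn l n)%N -> nth 0%N e i = absz d`_i.
  move=> lti; rewrite -nth_d1; have [ltd|ged] := ltnP i (size d1).
    by rewrite (nth_map 0) ?nth_take // size_take_min leq_min lti.
  by rewrite !nth_default // size_map size_take_min geq_min ged orbT.
exists e; split.
- rewrite all_map; apply/allP=> x /mem_take; rewrite mem_filter => /andP[nzx _].
  by rewrite /= absz_gt0.
- by rewrite sorted_map; apply/take_sorted/sorted_filter.
- by rewrite size_map size_take_min geq_minl.
pose s : 'rV[int]_l := \row_i (-1) ^+ (d`_i < 0)%R.
have ss : diag_mx s *m diag_mx s = 1%:M.
  rewrite mulmx_diag; apply/matrixP=> i j; rewrite !mxE -signr_addb addbb.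
  by [].
have [us _] := mulmx1_unit ss.
exists (diag_mx s *m invmx L), (invmx R); split.
- by rewrite unitmx_mul us unitmx_inv.
- by rewrite unitmx_inv.
rewrite -!mulmxA mulKmx // !mulmxA mulmxK //.
apply/matrixP=> i j; rewrite mul_diag_mx !mxE.
have [eij|_] := eqVneq (i : nat) (j : nat); last by rewrite !mulr0n mulr0.
rewrite !mulr1n nth_e; last by rewrite leq_min ltn_ord eij ltn_ord.
by rewrite abszE -normrEsign.
Qed.

Lemma size_invariant_factors B (d : seq nat) :
  invariant_factors B d -> size d = \rank (map_mx intr B : 'M[rat]_(l, n)).
Proof.
case=> pos_d _ le_d [P [Q [uP uQ eqD]]].
pose f k1 k2 (C : 'M[int]_(k1, k2)) : 'M[rat]_(k1, k2) := map_mx intr C.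
have unit_f k (C : 'M[int]_k) : C \in unitmx -> f _ _ C \in unitmx.
  move=> uC; have: f _ _ C *m f _ _ (invmx C) = 1%:M.
    by rewrite /f -map_mxM mulmxV // map_mx1.
  by case/mulmx1_unit.
have -> : \rank (f _ _ B) = \rank (f _ _ (P *m B *m Q)).
  rewrite /f !map_mxM mxrankMfree ?row_free_unit ?unit_f //.
  by rewrite -[in RHS]mxrank_tr trmx_mul mxrankMfree ?mxrank_tr // row_free_unit
     unitmx_tr unit_f.
pose u : 'rV[rat]_l := \row_i (nth 1%N d i)%:R.
have uu : diag_mx u \in unitmx.
  rewrite unitmxE det_diag unitfE; apply/prodf_neq0=> i _; rewrite mxE pnatr_eq0.
  have [lti|gei] := ltnP i (size d); last by rewrite nth_default.
  by rewrite -lt0n; apply: (allP pos_d); apply: mem_nth.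
have -> : f _ _ (P *m B *m Q) = diag_mx u *m pid_mx (size d).
  rewrite eqD; apply/matrixP=> i j; rewrite mul_diag_mx !mxE.
  have [_|_] /= := eqVneq (i : nat) (j : nat); last by rewrite mulr0.
  have [lti|gei] := ltnP i (size d).
    by rewrite mulr1 mulr1n -pmulrn; congr (_%:R); apply: set_nth_default.
  by rewrite mulr0 nth_default.
rewrite -mxrank_tr trmx_mul mxrankMfree ?row_free_unit ?unitmx_tr //.
by move: le_d; rewrite leq_min => /andP[? ?]; rewrite mxrank_tr rank_pid_mx.
Qed.

End Defs.

(* Main.v *)
(** Reduction modulo [q] maps [V_pq] to [V_q] and sends each [H_{i,pq}] into
    [H_{i,q}], so it suffices that it maps [V_pq] onto [V_q].  As [V_pq] is
    nonempty, this means that every solution of [B w = 0] modulo [q] lifts to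
    a solution modulo [pq].  The Smith normal form reduces this to the equation
    [d w = 0] for an invariant factor [d], where [w] is a multiple of
    [q / gcd(q, d)]; the divisibility hypothesis makes [p / gcd(p, d)] coprime
    to [gcd(q, d)], and so adding a multiple of [q] to [w] makes it divisible by
    [(p / gcd(p, d)) * (q / gcd(q, d))].  Without equations there are no
    invariant factors, and the hypotheses hold trivially. *)
Require Import Defs.
From mathcomp Require Import all_boot all_order all_algebra.
From mathcomp Require Import ring.

Set Implicit Arguments.
Unset Strict Implicit.
Unset Printing Implicit Defensive.

Import Order.TTheory GRing.Theory Num.Theory.
Local Open Scope ring_scope.

(** If [t] is the gcd in question, [gcdn p d * t] divides [p] because [t] divides [p %/ gcdn p d],
    and divides [d] because [t] divides [gcdn q d]. So it divides [gcdn p d], which forces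
    [t = 1]. *)
Lemma coprime_divn_gcdn (p q d : nat) : (0 < p)%N ->
  (gcdn p d * gcdn q d %| d)%N -> coprime (p %/ gcdn p d) (gcdn q d).
Proof.
move=> p_gt0 gd; have g_gt0 : (0 < gcdn p d)%N by rewrite gcdn_gt0 p_gt0.
set t := gcdn (p %/ gcdn p d) (gcdn q d).
suff: (gcdn p d * t %| gcdn p d)%N.
  by rewrite -{2}[gcdn p d]muln1 dvdn_pmul2l // dvdn1.
rewrite dvdn_gcd; apply/andP; split.
  by rewrite -{2}(divnK (dvdn_gcdl p d)) mulnC dvdn_pmul2r // dvdn_gcdl.
by apply: dvdn_trans gd; rewrite dvdn_pmul2l // dvdn_gcdr.
Qed.

Lemma lift_annihilator (p q d : nat) (w : int) : (0 < p)%N -> (0 < q)%N ->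
  (gcdn p d * gcdn q d %| d)%N -> (q%:Z %| d%:Z * w)%Z ->
  exists w' : int, (q%:Z %| w' - w)%Z && ((p * q)%N%:Z %| d%:Z * w')%Z.
Proof.
move=> p_gt0 q_gt0 gd qdw.
have /(coprime_divn_gcdn p_gt0) co := gd.
have gq_gt0 : (0 < gcdn q d)%N by rewrite gcdn_gt0 q_gt0.
have [q1 Eq] : exists q1, q = (q1 * gcdn q d)%N.
  by exists (q %/ gcdn q d)%N; rewrite divnK ?dvdn_gcdl.
have [d1 Ed] : exists d1, d = (d1 * gcdn q d)%N.
  by exists (d %/ gcdn q d)%N; rewrite divnK ?dvdn_gcdr.
have co1 : coprime q1 d1.
  rewrite /coprime -(eqn_pmul2r gq_gt0) mul1n muln_gcdl.
  by rewrite -Eq -Ed.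
have [u Eu] : exists u, w = u * q1%:Z.
  apply/dvdzP; rewrite -(@Gauss_dvdzr _ d1%:Z) //.
  by rewrite -(@dvdz_mul2r (gcdn q d)%:Z) ?gt_eqF // mulrAC -!PoszM -Eq -Ed.
have [d2 Ed2] : exists d2, d = (d2 * (gcdn p d * gcdn q d))%N by apply/dvdnP.
set g := gcdn q d in co gq_gt0 Eq Ed co1 Eu Ed2 gd *.
set h := gcdn p d in co Ed2 gd *.
have [p1 Ep] : exists p1, p = (p1 * h)%N.
  by exists (p %/ h)%N; rewrite divnK ?dvdn_gcdl.
have h_gt0 : (0 < h)%N by rewrite gcdn_gt0 p_gt0.
move: co; rewrite {1}Ep mulnK // => co.
have [[x y] /= Exy] : exists xy : int * int, xy.1 * p1%:Z + xy.2 * g%:Z = 1.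
  have [x [y E]] := Bezoutz p1%:Z g%:Z; exists (x, y); rewrite E.
  by rewrite /gcdz /= (eqP co).
(* Since [w = u * q1], [q = q1 * g] and [1 - y * g = x * p1], this witness equals [u * x * p1 * q1];
   multiplying by [d = d2 * h * g] completes [p1 * q1] to [p * q]. *)
exists (w - u * y * q%:Z); apply/andP; split.
  by rewrite addrAC subrr add0r rpredN dvdz_mull.
apply/dvdzP; exists (d2%:Z * u * x).
have -> : w - u * y * q%:Z = u * x * p1%:Z * q1%:Z.
  rewrite Eu Eq PoszM -{1}[u]mulr1 -Exy; ring.
rewrite {1}Ed2 {1}Ep {1}Eq !PoszM; ring.
Qed.

(** In the coordinates [invmx Q *m w] the system is diagonal, so each coordinate lifts on its own.
    Multiplying by an integer matrix preserves entrywise divisibility, which carries the conditions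
    back and forth. *)
Lemma lift_kernel (l n : nat) (B : 'M[int]_(l, n)) (d : seq nat) (p q : nat)
    (w : 'cV[int]_n) :
  invariant_factors B d -> (0 < p)%N -> (0 < q)%N ->
  (forall i, (i < size d)%N ->
    (gcdn p (nth 0%N d i) * gcdn q (nth 0%N d i) %| nth 0%N d i)%N) ->
  (forall i, (q%:Z %| (B *m w) i 0%R)%Z) ->
  exists w' : 'cV[int]_n,
    (forall j, (q%:Z %| (w' - w) j 0%R)%Z) /\
    (forall i, ((p * q)%N%:Z %| (B *m w') i 0%R)%Z).
Proof.
case=> _ _ size_d [P [Q [uP uQ eqD]]] p_gt0 q_gt0 gd qBw.
have dvd_mulmx (k : int) k1 k2 (C : 'M[int]_(k1, k2)) (v : 'cV_k2) :
    (forall j, (k %| v j 0%R)%Z) -> forall i, (k %| (C *m v) i 0%R)%Z.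
  by move=> kv i; rewrite mxE rpred_sum // => j _; rewrite dvdz_mull.
set D := (X in _ = X) in eqD.
have D_E (v : 'cV[int]_n) (i : 'I_l) (j : 'I_n) : i = j :> nat ->
    (D *m v) i 0 = (nth 0%N d j)%:Z * v j 0.
  move=> eij; rewrite mxE (bigD1 j) //= mxE eij eqxx mulr1n big1 ?addr0 // => k.
  rewrite mxE eij eq_sym -val_eqE => /negPf->; by rewrite mulr0n mul0r.
have qDu i : (q%:Z %| (D *m (invmx Q *m w)) i 0%R)%Z.
  by rewrite -eqD -!mulmxA mulKVmx //; apply: dvd_mulmx.
have liftu (j : 'I_n) : exists u' : int,
    (q%:Z %| u' - (invmx Q *m w) j 0%R)%Z &&
    ((p * q)%N%:Z %| (nth 0%N d j)%:Z * u')%Z.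
  (* Past the end of [d] the coefficient is the default 0, so the coordinate is free and is kept. *)
  have [ltj|gej] := ltnP j (size d); last first.
    by exists ((invmx Q *m w) j 0); rewrite subrr nth_default // mul0r !dvdz0.
  apply: lift_annihilator => //; first exact: gd.
  have ltjl : (j < l)%N.
    by apply: leq_trans ltj (leq_trans size_d (geq_minl _ _)).
  by rewrite -(@D_E _ (Ordinal ltjl)).
have [f fP] := fin_all_exists liftu.
pose u' : 'cV[int]_n := \col_j f j.
exists (Q *m u'); split=> [j|i].
  have -> : Q *m u' - w = Q *m (u' - invmx Q *m w).
    by rewrite mulmxBr mulKVmx.
  apply: dvd_mulmx => {}j; have /andP[+ _] := fP j.
  by rewrite !mxE.
have -> : B *m (Q *m u') = invmx P *m (D *m u').
  by rewrite -eqD -!mulmxA mulKmx.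
apply: dvd_mulmx => {}i.
(* A row of [D] with index at least [n] has no diagonal entry and vanishes. *)
have [ltin|gein] := ltnP i n.
  rewrite (@D_E _ _ (Ordinal ltin)) // mxE.
  by have /andP[] := fP (Ordinal ltin).
rewrite mxE big1 ?dvdz0 // => k _; rewrite mxE.
by rewrite gtn_eqF ?mulr0n ?mul0r // (leq_trans (ltn_ord k)).
Qed.

(** A section of reduction: integer representatives allow solutions for the moduli [q] and [p * q]
    to be compared through divisibility. *)
Definition lift_int (q : nat) (x : Zmod q) : int := (x : nat)%:Z.

Lemma lift_intK (q : nat) : cancel (@lift_int q) intr.
Proof.
move=> x; rewrite /lift_int -pmulrn.
have natrE (k : nat) : k%:R = inZp k :> Zmod q.
  elim: k => [|k IHk]; first by apply: val_inj; rewrite /= mod0n.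
  by rewrite mulrS IHk; apply: val_inj; rewrite /= modnDm add1n.
by rewrite natrE; apply: valZpK.
Qed.

Definition lift_mx (q k1 k2 : nat) (C : 'M[Zmod q]_(k1, k2)) : 'M[int]_(k1, k2) :=
  map_mx (@lift_int q) C.

Lemma lift_mxK (q k1 k2 : nat) : cancel (@lift_mx q k1 k2) (@mxmod q k1 k2).
Proof. by move=> C; apply/matrixP=> i j; rewrite !mxE lift_intK. Qed.

Lemma mxmodM (q k1 k2 k3 : nat) (C : 'M[int]_(k1, k2)) (D : 'M[int]_(k2, k3)) :
  mxmod q (C *m D) = mxmod q C *m mxmod q D.
Proof. exact: map_mxM. Qed.

Lemma mxmod_eqP (q k : nat) (x y : 'cV[int]_k) : (0 < q)%N ->
  reflect (forall i, (q%:Z %| (x - y) i 0%R)%Z) (mxmod q x == mxmod q y).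
Proof.
move=> q0; apply: (iffP eqP) => [/matrixP E i|E].
  have := E i 0; rewrite !mxE => /eqP.
  by rewrite intr_Zmod_eq // eqz_mod_dvd.
apply/matrixP=> i j; rewrite (ord1 j) !mxE; apply/eqP.
by rewrite intr_Zmod_eq // eqz_mod_dvd; have := E i; rewrite !mxE.
Qed.

Lemma mxmod_dvd (p q k : nat) (x y : 'cV[int]_k) : (0 < p)%N -> (0 < q)%N ->
  mxmod (p * q) x = mxmod (p * q) y -> mxmod q x = mxmod q y.
Proof.
move=> p0 q0 /eqP/mxmod_eqP E; apply/eqP/mxmod_eqP=> // i.
by apply: dvdz_trans (E _ i); rewrite ?muln_gt0 ?p0 // PoszM dvdz_mull.
Qed.

Lemma ColP (q l n : nat) (B : 'M[int]_(l, n)) (y : 'cV[Zmod q]_l) :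
  reflect (exists x, y = mxmod q B *m x) (y \in Col q B).
Proof.
apply: (iffP imsetP) => [[c _ ->]|[x ->]].
  exists (\col_j c j); apply/matrixP=> i k.
  by rewrite summxE mxE; apply: eq_bigr => j _; rewrite !mxE mulrC.
exists [ffun j => x j 0] => //; apply/matrixP=> i k; rewrite (ord1 k).
by rewrite summxE mxE; apply: eq_bigr => j _; rewrite !mxE ffunE mulrC.
Qed.

Lemma mem_mxmod_M (q m n l : nat) (A : 'M[int]_(m, n)) (a : 'cV[int]_m)
    (B : 'M[int]_(l, n)) (b : 'cV[int]_l) (x : 'cV[int]_n) : (0 < q)%N ->
  (mxmod q x \in M q A a B b) =
    (mxmod q (B *m x) == mxmod q b) &&
    [forall i, ~~ (q%:Z %| (A *m x - a) i 0%R)%Z].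
Proof.
move=> q0; rewrite inE andbC [in X in X && _]inE -mxmodM.
case: eqP => //= Vx; rewrite -negb_exists; congr (~~ _).
have HE i : (mxmod q x \in H q A a B b i) = (q%:Z %| (A *m x - a) i 0%R)%Z.
  rewrite 2!inE -!mxmodM Vx eqxx mxE /= -row_mul mxE intr_Zmod_eq // eqz_mod_dvd.
  by rewrite !mxE.
by apply/bigcupP/existsP => [[i _]|[i]]; [|exists i => //];
   rewrite ?HE // => Hi; exists i.
Qed.

Lemma card_M_le (m n l : nat) (A : 'M[int]_(m, n)) (a : 'cV[int]_m)
    (B : 'M[int]_(l, n)) (b : 'cV[int]_l) (d : seq nat) (p q : nat) :
  invariant_factors B d -> (0 < p)%N -> (0 < q)%N ->
  (forall i : nat, (i < size d)%N ->
     (gcdn p (nth 0%N d i) * gcdn q (nth 0%N d i) %| nth 0%N d i)%N) ->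
  mxmod (p * q) b \in Col (p * q) B ->
  (#|M q A a B b| <= #|M (p * q) A a B b|)%N.
Proof.
move=> Bd p0 q0 gd /ColP[y0]; have pq0 : (0 < p * q)%N by rewrite muln_gt0 p0.
rewrite -[y0]lift_mxK -mxmodM; move: (lift_mx y0) => {y0} y /eqP Ey.
pose red (x : 'cV[Zmod (p * q)]_n) := mxmod q (lift_mx x).
(* An image has at most as many elements as its source, so covering [M q A a B b] is enough. *)
suff sub : M q A a B b \subset red @: M (p * q) A a B b.
  exact: leq_trans (subset_leq_card sub) (leq_imset_card _ _).
apply/subsetP => x0; rewrite -[x0]lift_mxK; move: (lift_mx x0) => {x0} x.
rewrite mem_mxmod_M // => /andP[/eqP Vx /forallP Hx].
have Ey' := mxmod_dvd p0 q0 (eqP Ey).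
have qB i : (q%:Z %| (B *m (x - y)) i 0%R)%Z.
  by rewrite mulmxBr; move: i; apply/mxmod_eqP; rewrite // Vx Ey'.
(* The difference [x - y] of two solutions modulo [q] lifts to [w]; then [y + w] solves the system
   modulo [p * q] and reduces to [x] modulo [q]. *)
have [w [wE Bw]] := lift_kernel Bd p0 q0 gd qB.
have zE : mxmod q x = mxmod q (y + w).
  apply/esym/eqP/mxmod_eqP => // i; have := wE i.
  by rewrite opprB addrA [y + w]addrC.
apply/imsetP; exists (mxmod (p * q) (y + w)); last first.
  by rewrite zE; apply: (mxmod_dvd p0); rewrite ?lift_mxK.
rewrite mem_mxmod_M //; apply/andP; split.
  rewrite (eqP Ey); apply/mxmod_eqP => // i.
  by rewrite mulmxDr addrAC subrr add0r.
(* If [y + w] satisfied the [i]-th hyperplane equation modulo [p * q], then [x], congruent to it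
   modulo [q], would satisfy it modulo [q]. *)
apply/forallP=> i; apply: contra (Hx i) => pqA.
have qA : (q%:Z %| (A *m (y + w) - a) i 0%R)%Z.
  by apply: dvdz_trans pqA; rewrite PoszM dvdz_mull.
have /eqP/mxmod_eqP-/(_ q0 i) dA : mxmod q (A *m x) = mxmod q (A *m (y + w)).
  by rewrite !mxmodM zE.
have -> : A *m x - a = (A *m x - A *m (y + w)) + (A *m (y + w) - a).
  by rewrite addrA subrK.
by rewrite mxE rpredD.
Qed.

Theorem theorem3p12 (m n l : nat) (A : 'M[int]_(m, n)) (a : 'cV[int]_m)
    (B : 'M[int]_(l, n)) (b : 'cV[int]_l) :
  (forall d : seq nat, invariant_factors B d ->
   forall p q : nat, (0 < p)%N -> (0 < q)%N ->
   (forall i : nat, (i < size d)%N ->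
      (gcdn p (nth 0%N d i) * gcdn q (nth 0%N d i) %| nth 0%N d i)%N) ->
   mxmod (p * q) b \in Col (p * q) B ->
   (#|M q A a B b| <= #|M (p * q) A a B b|)%N)
  /\
  (l = 0%N ->
   forall p q : nat, (0 < p)%N -> (0 < q)%N ->
   (#|M q A a B b| <= #|M (p * q) A a B b|)%N).
Proof.
split=> [d Bd p q p0 q0 gd bB | l0 p q p0 q0]; first exact: (card_M_le A a Bd).
move: B b; rewrite l0 => B b.
have [d Bd] := invariant_factors_exist B.
apply: (card_M_le A a Bd) => // [i|].
  (* The size bound [minn 0 n] forces [d] to be empty. *)
  have [_ _ + _] := Bd; rewrite min0n leqn0 => /eqP->.
  by rewrite ltn0.
by apply/ColP; exists 0; rewrite [LHS]flatmx0 [RHS]flatmx0.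
Qed.
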